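(* Let $\mathcal{R}=(R,0,\leq,\oplus)$ be a countable archimedean distance monoid, let $\mathcal{U}$ be an $\mathcal{R}$-Urysohn space and $G=\mathrm{Isom}(\mathcal{U})$. Let $\tau$ be $\tau_m$ if for every $r\in R\setminus\{0\}$ there exists $s\in R\setminus\{0\}$ with $s\oplus s\leq r$, and let $\tau=\tau_{st}$ otherwise. Then $\tau$ is the coarsest non-trivial group topology on $G$ coarser than $\tau_{st}$; that is, $\tau\subseteq\tau_{st}$ and every group topology $\tau'\subseteq\tau_{st}$ on $G$ with $\tau'\neq\{\emptyset,G\}$ satisfies $\tau\subseteq\tau'$. In particular, $(G,\tau)$ is totally minimal.
   Context: A distance monoid is a structure $(R,0,\leq,\oplus)$ where $\leq$ is a linear order on $R$ and $\oplus$ is an associative, commutative operation with $s\oplus 0=s$, $r\leq r\oplus s$, and $s\leq s'\Rightarrow s\oplus t\leq s'\oplus t$. For $m\in\mathbb{N}$, $m\cdot s$ is the $\oplus$-sum of $m$ copies of $s$. It is archimedean if for all $r,s\in R\setminus\{0\}$ there is $m$ with $m\cdot s\geq r$. An $\mathcal{R}$-metric space is a set $X$ with $d:X^2\to R$ such that $d(x,y)=0\iff x=y$, $d(x,y)=d(y,x)$ and $d(x,z)\leq d(x,y)\oplus d(y,z)$. An $\mathcal{R}$-Urysohn space is an $\mathcal{R}$-metric space $\mathcal{U}$ into which every finite $\mathcal{R}$-metric space embeds isometrically and such that every isometry between finite subspaces of $\mathcal{U}$ extends to an isometry of $\mathcal{U}$. $\mathrm{Isom}(\mathcal{U})$ is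 its group of isometries. $\tau_{st}$ is the group topology on $G$ whose base of identity neighbourhoods is $\{G_A: A\subseteq\mathcal{U}\text{ finite}\}$, $G_A$ the pointwise stabilizer of $A$. When for every $r\neq 0$ there is $s\neq 0$ with $s\oplus s\leq r$, $\tau_m$ is the group topology on $G$ generated at the identity by the sets $N_u(\epsilon)=\{g\in G: d(gu,u)\leq\epsilon\}$, $u\in\mathcal{U}$, $\epsilon\in R\setminus\{0\}$. A Hausdorff topological group is totally minimal if every continuous surjective homomorphism onto a Hausdorff topological group is open.
   Formalization: When R has exactly two elements, τ_m is the trivial topology and not Hausdorff, so non-triviality of τ and the Hausdorff part of total minimality are claimed only for other R; non-triviality also excludes R={0}, where G is trivial. *)

(* Defs.v *)
From HB Require Import structures.
From mathcomp Require Import all_boot all_order.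
From mathcomp Require Import boolp classical_sets functions cardinality filter.

Set Implicit Arguments.
Unset Strict Implicit.
Unset Printing Implicit Defensive.

Import Order.TTheory.

Local Open Scope classical_set_scope.

Declare Scope dist_scope.
Local Open Scope dist_scope.

HB.mixin Record isDistMonoid (disp : Order.disp_t) R of Order.Total disp R := {
  dzero : R;
  dplus : R -> R -> R;
  dplusA : associative dplus;
  dplusC : commutative dplus;
  dplus0 : right_id dzero dplus;
  le_dplusr : forall r s : R, (r <= dplus r s)%O;
  le_dplus2r : forall s s' t : R, (s <= s')%O -> (dplus s t <= dplus s' t)%O
}.

#[short(type="distMonoidType")]
HB.structure Definition DistMonoid (disp : Order.disp_t) :=
  {R of isDistMonoid disp R & Order.Total disp R}.

Notation "0" := dzero : dist_scope.
Notation "x (+) y" := (dplus x y) : dist_scope.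

Definition dmuln disp (R : distMonoidType disp) (m : nat) (s : R) : R :=
  iter m (dplus s) 0.

Definition dist_archimedean disp (R : distMonoidType disp) : Prop :=
  forall r s : R, r != 0 -> s != 0 -> exists m : nat, (r <= dmuln m s)%O.

Definition dist_halving disp (R : distMonoidType disp) : Prop :=
  forall r : R, r != 0 -> exists2 s : R, s != 0 & (s (+) s <= r)%O.

(* [choiceType] is no restriction on the carrier: classically every type has
   such a structure. *)
HB.mixin Record isRMetric disp (R : distMonoidType disp) X of Choice X := {
  rdist : X -> X -> R;
  rdist_eq0 : forall x y, rdist x y = 0 <-> x = y;
  rdistC : forall x y, rdist x y = rdist y x;
  rdist_triangle : forall x y z, (rdist x z <= rdist x y (+) rdist y z)%O
}.

#[short(type="rmetricType")]
HB.structure Definition RMetric disp (R : distMonoidType disp) :=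
  {X of isRMetric disp R X & Choice X}.

Definition finitely_universal disp (R : distMonoidType disp)
    (U : rmetricType R) : Prop :=
  forall F : rmetricType R, finite_set [set: F] ->
    exists f : F -> U, forall x y, rdist (f x) (f y) = rdist x y.

(* A map between the finite subspaces A and B is represented by a function on
   U of which only the restriction to A matters. *)
Definition ultrahomogeneous disp (R : distMonoidType disp)
    (U : rmetricType R) : Prop :=
  forall (A B : set U) (f : U -> U), finite_set A -> finite_set B ->
    set_bij A B f ->
    (forall x y, A x -> A y -> rdist (f x) (f y) = rdist x y) ->
    exists g : U -> U, [/\ bijective g,
      forall x y, rdist (g x) (g y) = rdist x y &
      forall x, A x -> g x = f x].

Definition urysohn disp (R : distMonoidType disp) (U : rmetricType R) : Prop :=
  finitely_universal U /\ ultrahomogeneous U.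

Record isom disp (R : distMonoidType disp) (U : rmetricType R) := Isom {
  isom_fun :> U -> U;
  isom_bij : bijective isom_fun;
  isom_dist : forall x y, rdist (isom_fun x) (isom_fun y) = rdist x y
}.

Section IsomGroup.
Context disp (R : distMonoidType disp) (U : rmetricType R).
Implicit Types f g : isom U.

Lemma isom_ext f g : f =1 g -> f = g.
Proof.
case: f => f fb fd; case: g => g gb gd /= /funext fg; subst g.
by rewrite (Prop_irrelevance fb gb) (Prop_irrelevance fd gd).
Qed.

HB.instance Definition _ := gen_eqMixin (isom U).
HB.instance Definition _ := gen_choiceMixin (isom U).

Lemma isom_id_bij : bijective (id : U -> U). Proof. by exists id. Qed.

Definition isom1 : isom U := Isom isom_id_bij (fun=> fun=> erefl).

Lemma isom_comp_dist f g x y : rdist (f (g x)) (f (g y)) = rdist x y.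
Proof. by rewrite !isom_dist. Qed.

Definition isom_mul f g : isom U :=
  @Isom _ _ _ (f \o g) (bij_comp (isom_bij f) (isom_bij g))
    (isom_comp_dist f g).

Lemma isom_has_inverse f : exists g : isom U, cancel f g /\ cancel g f.
Proof.
have [h fK hK] := isom_bij f.
have hb : bijective h by exists f.
have hd x y : rdist (h x) (h y) = rdist x y by rewrite -(isom_dist f) !hK.
by exists (Isom hb hd).
Qed.

Definition isom_inv f : isom U := projT1 (cid (isom_has_inverse f)).

Lemma isom_invP f : cancel f (isom_inv f) /\ cancel (isom_inv f) f.
Proof. exact: projT2 (cid (isom_has_inverse f)). Qed.

Lemma isom_mulA : associative isom_mul.
Proof. by move=> f g h; exact: isom_ext. Qed.

Lemma isom_mul1 : left_id isom1 isom_mul.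
Proof. by move=> f; exact: isom_ext. Qed.

Lemma isom_mulr1 : right_id isom1 isom_mul.
Proof. by move=> f; exact: isom_ext. Qed.

Lemma isom_mulV : left_inverse isom1 isom_inv isom_mul.
Proof. by move=> f; apply: isom_ext => x /=; case: (isom_invP f) => ->. Qed.

Lemma isom_mulrV : right_inverse isom1 isom_inv isom_mul.
Proof. by move=> f; apply: isom_ext => x /=; case: (isom_invP f) => _ ->. Qed.

HB.instance Definition _ := isGroup.Build (isom U)
  isom_mulA isom_mul1 isom_mulr1 isom_mulV isom_mulrV.

End IsomGroup.

(* A topology is represented by its set of open sets, so that topologies on
   one fixed group are compared by inclusion. *)
Definition is_topology (T : Type) (tau : set_system T) : Prop :=
  [/\ tau setT,
      forall A B, tau A -> tau B -> tau (A `&` B) &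
      forall F : set_system T, F `<=` tau -> tau (\bigcup_(A in F) A)].

Definition trivial_topology (T : Type) : set_system T := [set set0; setT].

Arguments trivial_topology : clear implicits.

Definition hausdorff_topology (T : Type) (tau : set_system T) : Prop :=
  forall x y : T, x <> y ->
    exists A B : set T, [/\ tau A, tau B, A x, B y & A `&` B = set0].

Definition group_topology (G : groupType) (tau : set_system G) : Prop :=
  [/\ is_topology tau,
      forall (g h : G) (O : set G), tau O -> O (g * h)%g ->
        exists V W : set G, [/\ tau V, tau W, V g, W h &
          forall v w, V v -> W w -> O (v * w)%g] &
      forall O : set G, tau O -> tau [set g : G | O g^-1%g]].

(* If there is a group topology on G for which B is a base of neighbourhoods of
   the identity, it is this one. *)
Definition topology_at1 (G : groupType) (B : set_system G) : set_system G :=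
  [set O | forall g, O g -> exists2 V, B V & forall h, V h -> O (g * h)%g].

Definition pointwise_stab disp (R : distMonoidType disp) (U : rmetricType R)
    (A : set U) : set (isom U) :=
  [set g | forall a, A a -> g a = a].

Definition tau_st disp (R : distMonoidType disp) (U : rmetricType R) :
    set_system (isom U) :=
  topology_at1 [set pointwise_stab A | A in [set A : set U | finite_set A]].

Arguments tau_st {disp R} U _.

Definition displ_ball disp (R : distMonoidType disp) (U : rmetricType R)
    (u : U) (e : R) : set (isom U) :=
  [set g | (rdist (g u) u <= e)%O].

(* The sets N_u(e) generate the neighbourhoods of 1: their finite intersections
   form a base. *)
Definition tau_m disp (R : distMonoidType disp) (U : rmetricType R) :
    set_system (isom U) :=
  topology_at1 (finI_from [set p : U * R | p.2 != 0]
                          (fun p => displ_ball p.1 p.2)).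

Arguments tau_m {disp R} U _.

Definition tau_isom disp (R : distMonoidType disp) (U : rmetricType R) :
    set_system (isom U) :=
  if `[< dist_halving R >] then tau_m U else tau_st U.

Arguments tau_isom {disp R} U _.

(* Total minimality is a property of Hausdorff groups; the Hausdorff axiom is
   not part of this definition and has to be asserted separately. *)
Definition totally_minimal (G : groupType) (tau : set_system G) : Prop :=
  forall (H : groupType) (sigma : set_system H) (f : G -> H),
    group_topology sigma -> hausdorff_topology sigma ->
    {morph f : x y / (x * y)%g} ->
    (forall y, exists x, f x = y) ->
    (forall O : set H, sigma O -> tau (f @^-1` O)) ->
    forall O : set G, tau O -> sigma (f @` O).

(* When R = {0, s}, s is idempotent, R satisfies [dist_halving] and every
   N_u(s) is the whole group, so that tau_m is the trivial topology, which is
   not Hausdorff as soon as the group is not trivial. *)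
Definition two_element disp (R : distMonoidType disp) : Prop :=
  exists2 s : R, s != 0 & forall r : R, r = 0 \/ r = s.

(* Main.v *)
(* Let tau be a group topology coarser than tau_st and suppose that some N_u(e)
   is not a neighbourhood of 1, where e <> 0 in the halving case and e = 0
   otherwise.  By transitivity, every neighbourhood V of 1 then moves every
   point by more than e.  Conjugating V by an isometry which makes a copy of a
   finite set A free from A, one sees that V moves every point away from A, then
   (composing finitely many such elements) all points of A at once, by more
   than a fixed radius.  If g in V separates A and g A by at least t, then
   G_{gA} contains an isometry separating A from its image by at least t (+) t;
   as R is archimedean, V contains isometries moving A arbitrarily far.  Once
   the distance exceeds the diameter of A u h A, amalgamation puts the
   arbitrary isometry h in a bounded power of V, so that tau is trivial.
   Total minimality follows by applying this to the preimage topology. *)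

From HB Require Import structures.
Require Import Defs.
From mathcomp Require Import all_boot all_order.
From mathcomp Require Import finmap.
From mathcomp Require Import boolp classical_sets functions cardinality filter.
Set Implicit Arguments.
Unset Strict Implicit.
Unset Printing Implicit Defensive.

Import Order.TTheory.

Local Open Scope classical_set_scope.
Local Open Scope dist_scope.

(** * Inequalities in distance monoids and their metric spaces *)

Section DistMonoidTheory.
Context disp (R : distMonoidType disp).
Implicit Types r s t : R.

Lemma dplus0l : left_id (0 : R) (@dplus _ R).
Proof. by move=> r; rewrite dplusC dplus0. Qed.

Lemma dzero_le r : (0 <= r)%O.
Proof. by rewrite -(dplus0l r) le_dplusr. Qed.

Lemma dle0 r : (r <= 0)%O -> r = 0.
Proof. by move=> r0; apply/le_anti; rewrite r0 dzero_le. Qed.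

Lemma le_dplusl r s : (s <= r (+) s)%O.
Proof. by rewrite dplusC le_dplusr. Qed.

Lemma le_dplus r r' s s' :
  (r <= r')%O -> (s <= s')%O -> (r (+) s <= r' (+) s')%O.
Proof.
move=> rr' ss'; apply: le_trans (le_dplus2r _ _ _ rr') _.
by rewrite ![r' (+) _]dplusC le_dplus2r.
Qed.

End DistMonoidTheory.

Section RMetricTheory.
Context disp (R : distMonoidType disp) (U : rmetricType R).
Implicit Types (x y z : U).

Lemma rdistxx x : rdist x x = 0 :> R.
Proof. exact/rdist_eq0. Qed.

Lemma rdist_trianglel x y z : (rdist y z <= rdist x y (+) rdist x z)%O.
Proof. by rewrite (rdistC x y) rdist_triangle. Qed.

End RMetricTheory.

(** * Embedding finite pseudometric spaces *)

Section Embedding.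
Context disp (R : distMonoidType disp) (U : rmetricType R).
Hypothesis univU : finitely_universal U.

Section Canon.
Context (T : choiceType) (D : seq T) (rho : T -> T -> R).
Hypothesis rhoxx : {in D, forall x, rho x x = 0}.
Hypothesis rhoC : {in D &, forall x y, rho x y = rho y x}.
Hypothesis rho_tri :
  {in D & &, forall x y z, (rho x z <= rho x y (+) rho y z)%O}.

(* The quotient of D by [rho x y = 0], as a type of canonical
   representatives. *)
Let canon x := choose (fun y => (y \in D) && (rho x y == 0)) x.
Let F : choiceType := {x : T | (x \in D) && (canon x == x)}.

Let rhoF (x y : F) : R := rho (val x) (val y).

Let canonP x : x \in D -> (canon x \in D) /\ rho x (canon x) = 0.
Proof.
move=> xD; have := @chooseP _ (fun y => (y \in D) && (rho x y == 0)) x.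
by rewrite xD rhoxx // eqxx /= => /(_ isT) /andP[-> /eqP].
Qed.

Let rho0_le x y z : x \in D -> y \in D -> z \in D -> rho x y = 0 ->
  (rho x z <= rho y z)%O.
Proof.
by move=> xD yD zD xy0; have := rho_tri xD yD zD; rewrite xy0 dplus0l.
Qed.

Let rho0_eq x y z : x \in D -> y \in D -> z \in D -> rho x y = 0 ->
  rho x z = rho y z.
Proof.
move=> xD yD zD xy0; apply/le_anti/andP; split; first exact: rho0_le.
by apply: rho0_le => //; rewrite rhoC.
Qed.

Let canon_eq x y : x \in D -> y \in D -> rho x y = 0 -> canon x = canon y.
Proof.
move=> xD yD xy0; rewrite /canon.
rewrite (@eq_choose _ _ (fun z => (z \in D) && (rho y z == 0))); last first.
  by move=> z /=; case zD: (z \in D) => //=; rewrite (rho0_eq xD yD zD xy0).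
by apply: choose_id; rewrite ?yD ?xD ?xy0 ?(rhoxx yD) ?(rhoC yD xD) ?xy0 eqxx.
Qed.

Let rhoF_eq0 (x y : F) : rhoF x y = 0 <-> x = y.
Proof.
case: x y => [x xF] [y yF]; have /andP[xD /eqP cx] := xF.
have /andP[yD /eqP cy] := yF; rewrite /rhoF /=; split=> [xy0|[<-]].
  by apply: val_inj => /=; rewrite -cx -cy; exact: canon_eq.
exact: rhoxx.
Qed.

Let rhoFC (x y : F) : rhoF x y = rhoF y x.
Proof. by apply: rhoC; [have /andP[] := valP x|have /andP[] := valP y]. Qed.

Let rhoF_tri (x y z : F) : (rhoF x z <= rhoF x y (+) rhoF y z)%O.
Proof.
by apply: rho_tri; [have /andP[] := valP x|have /andP[] := valP y|
  have /andP[] := valP z].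
Qed.

(** The amalgams built below may have distinct points at distance 0, so finite universality is
    applied to the quotient of [D] by [rho x y = 0]. *)
Lemma pseudometric_embedding (u0 : U) :
  exists f : T -> U, {in D &, forall x y, rdist (f x) (f y) = rho x y}.
Proof.
pose m := isRMetric.Build disp R F rhoF_eq0 rhoFC rhoF_tri.
pose FM : rmetricType R := HB.pack F m.
have finF : finite_set [set: FM].
  apply: (@sub_finite_set _ _ [set` pmap (insub : T -> option F) D]).
    by move=> x _ /=; rewrite mem_pmap_sub; have /andP[] := valP x.
  exact: finite_seq.
have [f fE] := univU finF.
(* [u0] is a default value that is not taken on [D]. *)
exists (fun x => if insub (canon x) is Some y then f (y : F) else u0).
move=> x y xD yD.
have [cxD cx0] := canonP xD; have [cyD cy0] := canonP yD.
rewrite !insubT ?cxD ?cyD -?(canon_eq xD cxD) -?(canon_eq yD cyD) //=.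
move=> xF yF; rewrite fE /= /rdist /= /rhoF /=.
by rewrite -(rho0_eq xD cxD cyD cx0) rhoC // -(rho0_eq yD cyD xD cy0) rhoC.
Qed.
End Canon.

Lemma urysohn_inhabited : exists u : U, True.
Proof.
pose rho (x y : unit) : R := 0.
have rho0 x y : rho x y = 0 <-> x = y by case: x y => [] [].
have rhoC x y : rho x y = rho y x by [].
have rho_tri x y z : (rho x z <= rho x y (+) rho y z)%O by rewrite dzero_le.
pose m := isRMetric.Build disp R unit rho0 rhoC rho_tri.
have [|f _] := univU (F := HB.pack unit m); last by exists (f tt).
exact: finite_finset.
Qed.
End Embedding.

(** * Isometries with prescribed behaviour on finite sets *)

Section Urysohn.
Context disp (R : distMonoidType disp) (U : rmetricType R).
Hypothesis uryU : urysohn U.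
Local Notation d := (@rdist disp R U).
Implicit Types (s : seq U) (x y z u : U) (g h k : isom U).

(** Indexed families are used because the points to be mapped may repeat: equality of distances
    makes [u i = u j] equivalent to [v i = v j], so a well-defined bijection of finite sets
    remains. *)
Lemma isom_extension (I : eqType) (s : seq I) (u v : I -> U) :
  {in s &, forall i j, d (u i) (u j) = d (v i) (v j)} ->
  exists g : isom U, {in s, forall i, g (u i) = v i}.
Proof.
move=> uv; have [_ homU] := uryU.
pose F x := if [seq i <- s | u i == x] is i :: _ then v i else x.
have FE : {in s, forall i, F (u i) = v i}.
  move=> i si; rewrite /F; case E: [seq _ <- _ | _] => [|j t].
    have : i \in [seq j <- s | u j == u i] by rewrite mem_filter eqxx.
    by rewrite E.
  have : j \in [seq j <- s | u j == u i] by rewrite E mem_head.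
  rewrite mem_filter => /andP[/eqP uji sj].
  by apply/(@rdist_eq0 _ R); rewrite -uv // uji rdistxx.
pose A := [set` map u s].
have AP x : A x -> exists2 i, i \in s & x = u i by move=> /mapP.
have [] := homU A (F @` A) F.
- exact: finite_seq.
- exact/finite_image/finite_seq.
- split; first by move=> x Ax; exists x.
    move=> x y /set_mem/AP[i si ->] /set_mem/AP[j sj ->]; rewrite !FE // => vij.
    by apply/(@rdist_eq0 _ R); rewrite uv // vij rdistxx.
  by move=> x [y Ay <-]; exists y.
- by move=> x y /AP[i si ->] /AP[j sj ->]; rewrite !FE // uv.
move=> g [gb gd gF]; exists (Isom gb gd) => i si /=.
by rewrite gF ?FE //; apply/mapP; exists i.
Qed.

Lemma isom_transitive u v : exists g : isom U, g u = v.
Proof.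
have [i j _ _|g gE] := @isom_extension _ [:: tt] (fun=> u) (fun=> v).
  by rewrite !rdistxx.
by exists g; rewrite (gE tt).
Qed.

(** The hypotheses make two copies of [S], with [phi] as the distance between them, a pseudometric
    space. It embeds in [U], and ultrahomogeneity turns the passage from one copy to the other into
    an isometry. *)
Lemma prescribed_isom (S : seq U) (phi : U -> U -> R) :
  {in S &, forall x y, phi x y = phi y x} ->
  {in S & &, forall x y z, (d x y <= phi x z (+) phi z y)%O} ->
  {in S & &, forall x y z, (phi x y <= d x z (+) phi z y)%O} ->
  exists g : isom U, {in S &, forall x y, d (g x) y = phi x y}.
Proof.
move=> phiC d_le phi_le; have [univU _] := uryU.
have [u0 _] := urysohn_inhabited univU.
(* The points [inr x] are the copy of S which stays in place, the points
   [inl x] the copy which is moved. *)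
pose rho (a b : U + U) := match a, b with
  | inl x, inl y | inr x, inr y => d x y
  | inl x, inr y | inr x, inl y => phi x y
  end.
pose D := map inl S ++ map inr S : seq (U + U).
have DP a : a \in D -> match a with inl x | inr x => x \in S end.
  rewrite mem_cat => /orP[] /mapP[x Sx ->] //.
have DS x : x \in S -> (inl x \in D) * (inr x \in D).
  by move=> Sx; rewrite !mem_cat !map_f ?orbT.
have [] := @pseudometric_embedding _ R U univU _ D rho _ _ _ u0.
- by move=> [x|x] /DP Sx /=; rewrite rdistxx.
- by move=> [x|x] [y|y] /DP Sx /DP Sy /=; rewrite ?(phiC _ _ Sx Sy) // rdistC.
- have phi_le' : {in S & &, forall x y z, (phi x y <= phi x z (+) d z y)%O}.
    move=> x y z Sx Sy Sz; rewrite phiC // dplusC (phiC x) // (rdistC z).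
    exact: phi_le.
  move=> [x|x] [y|y] [z|z] /DP Sx /DP Sy /DP Sz /=;
  by rewrite ?rdist_triangle ?d_le ?phi_le ?phi_le'.
move=> f fE.
(* [p] carries [S] to the copy that stays and [q] to the moved one, so [p^-1 * q] has the required
   distances to [S] itself. *)
have [p pE] : exists p : isom U, {in S, forall x, p x = f (inr x)}.
  apply: (@isom_extension _ S id (f \o inr)) => x y Sx Sy /=.
  by rewrite fE ?(DS _ Sx) ?(DS _ Sy).
have [q qE] : exists q : isom U, {in S, forall x, q x = f (inl x)}.
  apply: (@isom_extension _ S id (f \o inl)) => x y Sx Sy /=.
  by rewrite fE ?(DS _ Sx) ?(DS _ Sy).
exists (p^-1 * q)%g => x y Sx Sy.
rewrite -(isom_dist p) /= (proj2 (isom_invP p)) qE // pE //.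
by rewrite fE ?(DS _ Sx) ?(DS _ Sy).
Qed.

Lemma argmin_seq (T : eqType) (s : seq T) (f : T -> R) : s != [::] ->
  exists2 a, a \in s & {in s, forall b, (f a <= f b)%O}.
Proof.
elim: s => // a [|b t] IHs _.
  by exists a; rewrite ?mem_head // => b; rewrite inE => /eqP ->.
have [//|c ct cmin] := IHs.
have [ac|/ltW ca] := leP (f a) (f c).
  exists a; rewrite ?mem_head // => x; rewrite inE => /orP[/eqP -> //|/cmin].
  exact: le_trans.
by exists c => [|x]; rewrite inE ?ct ?orbT // => /orP[/eqP -> //|/cmin].
Qed.

(** This is the free amalgam of [A ++ S] with itself over [A]: the cross distance is the length of a
    shortest path through [A]. It is 0 from a point of [A] to itself, which forces [g] to fix
    [A]. *)
Lemma free_amalgam_isom (A S : seq U) : A != [::] ->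
  exists2 g : isom U, {in A, forall a, g a = a} &
    {in S &, forall x y, exists2 a, a \in A & d (g x) y = d x a (+) d a y}.
Proof.
move=> A0.
have /choice[m mP] (p : U * U) : exists a, a \in A /\
    {in A, forall b, (d p.1 a (+) d a p.2 <= d p.1 b (+) d b p.2)%O}.
  by have [a] := argmin_seq (fun a => d p.1 a (+) d a p.2) A0; exists a.
pose phi x y := d x (m (x, y)) (+) d (m (x, y)) y.
have phiA x y : m (x, y) \in A by have [] := mP (x, y).
have phi_le x y a : a \in A -> (phi x y <= d x a (+) d a y)%O.
  by move=> Aa; have [_ /(_ a Aa)] := mP (x, y).
have d_phi x y : (d x y <= phi x y)%O by exact: rdist_triangle.
have [] := @prescribed_isom (A ++ S) phi.
- move=> x y _ _; apply/le_anti/andP; split.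
    apply: le_trans (phi_le x y _ (phiA y x)) _.
    by rewrite /phi dplusC ![d x _]rdistC ![d _ y]rdistC.
  apply: le_trans (phi_le y x _ (phiA x y)) _.
  by rewrite /phi dplusC ![d y _]rdistC ![d _ x]rdistC.
- move=> x y z _ _ _; apply: le_trans (le_dplus (d_phi _ _) (d_phi _ _)).
  exact: rdist_triangle.
- move=> x y z _ _ _; apply: le_trans (phi_le x y _ (phiA z y)) _.
  by rewrite /phi dplusA le_dplus2r ?rdist_triangle.
move=> g gE; exists g => [a Aa|x y Sx Sy].
  apply/(@rdist_eq0 _ R)/dle0; rewrite gE ?mem_cat ?Aa //.
  by rewrite (le_trans (phi_le _ _ _ Aa)) // rdistxx dplus0.
by exists (m (x, y)); rewrite ?phiA // gE // mem_cat ?Sx ?Sy orbT.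
Qed.

(** Only the distances between [A] and its moved copy are changed, to [D]. No distance shrinks, as
    [D] bounds the diameter of [A], and a path through [B] is no shortcut, as [B] is at least [D]
    away from [A]. *)
Lemma constant_distance_isom (A B : seq U) (D : R) :
  {in A &, forall x y, (d x y <= D)%O} ->
  {in A & B, forall x y, (D <= d x y)%O} ->
  exists2 g : isom U, {in B, forall b, g b = b} &
    {in A &, forall x y, d (g x) y = D}.
Proof.
move=> diamA distAB.
(* For [D = 0] all points of [A] coincide and may lie in [B]; otherwise [A] and [B] are disjoint. *)
have [D0|D0] := eqVneq D 0.
  exists 1%g => // x y Ax Ay /=; apply/le_anti; rewrite diamA // D0 dzero_le //.
have disjAB x : x \in A -> x \in B -> False.
  move=> Ax Bx; move: D0; rewrite -(rdistxx x); apply/negP; rewrite negbK.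
  by rewrite eq_le distAB // rdistxx dzero_le.
pose phi x y := if (x \in A) && (y \in A) then D else d x y.
have phiC x y : phi x y = phi y x by rewrite /phi andbC rdistC.
have d_phi x y : (d x y <= phi x y)%O.
  by rewrite /phi; case: ifP => // /andP[]; exact: diamA.
have [] := @prescribed_isom (A ++ B) phi.
- by move=> x y _ _; exact: phiC.
- move=> x y z _ _ _; apply: le_trans (le_dplus (d_phi _ _) (d_phi _ _)).
  exact: rdist_triangle.
- move=> x y z _ _; rewrite mem_cat => zAB; rewrite {1}/phi; case: ifPn.
    move=> /andP[Ax Ay]; have [Az|Az] := boolP (z \in A).
      by rewrite /phi Az Ay le_dplusl.
    rewrite (negPf Az) /= in zAB.
    exact: le_trans (distAB _ _ Ax zAB) (le_dplusr _ _).
  move=> _; apply: le_trans (le_dplus (lexx _) (d_phi _ _)).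
  exact: rdist_triangle.
move=> g gE; exists g => [b Bb|x y Ax Ay].
  apply/(@rdist_eq0 _ R); rewrite gE ?mem_cat ?Bb ?orbT // /phi.
  by case: ifP => [/andP[/disjAB]|_]; rewrite ?rdistxx // Bb => /(_ isT).
by rewrite gE ?mem_cat ?Ax ?Ay // /phi Ax Ay.
Qed.

End Urysohn.

(** * Neighbourhoods of the identity in a group topology *)

Section GroupTopology.
Local Open Scope group_scope.
Context (G : groupType) (tau : set_system G).

Definition nbhs1 : set_system G :=
  [set V | exists O, [/\ tau O, O 1 & O `<=` V]].

Lemma topology_nbhsP : is_topology tau -> forall O : set G,
  (forall x, O x -> exists W, [/\ tau W, W x & W `<=` O]) -> tau O.
Proof.
move=> [_ _ tauU] O Onb.
have -> : O = \bigcup_(W in [set W | tau W /\ W `<=` O]) W.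
  apply/seteqP; split=> [x /Onb[W [tW Wx WO]]|x [W [_ WO] /WO//]].
  by exists W.
by apply: tauU => W [].
Qed.

Hypothesis gtau : group_topology tau.
Let top_tau : is_topology tau. Proof. by case: gtau. Qed.

Lemma group_topology_translate (g : G) (O : set G) :
  tau O -> tau [set h | O (g * h)].
Proof.
case: gtau => _ tauM _ tO; apply: topology_nbhsP => // h Ogh.
have [V [W [_ tW Vg Wh VWO]]] := tauM g h O tO Ogh.
by exists W; split=> // w Ww; exact: VWO.
Qed.

Lemma group_topology_translater (g : G) (O : set G) :
  tau O -> tau [set h | O (h * g)].
Proof.
case: gtau => _ tauM _ tO; apply: topology_nbhsP => // h Ohg.
have [V [W [tV _ Vh Wg VWO]]] := tauM h g O tO Ohg.
by exists V; split=> // v Vv; exact: VWO.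
Qed.

Lemma nbhs1_mem1 V : nbhs1 V -> V 1.
Proof. by move=> [O [_ O1 /(_ _ O1)]]. Qed.

Lemma nbhs1S V W : V `<=` W -> nbhs1 V -> nbhs1 W.
Proof. by move=> VW [O [tO O1 OV]]; exists O; split=> // x /OV/VW. Qed.

Lemma nbhs1I V W : nbhs1 V -> nbhs1 W -> nbhs1 (V `&` W).
Proof.
case: top_tau => _ tauI _ [O [tO O1 OV]] [P [tP P1 PW]].
by exists (O `&` P); split; [exact: tauI| |move=> x [/OV ? /PW ?]].
Qed.

Lemma nbhs1_conj V g : nbhs1 V -> nbhs1 [set h | V (g^-1 * h * g)].
Proof.
move=> [O [tO O1 OV]]; exists [set h | O (g^-1 * h * g)].
split=> [| |h /OV//]; last by rewrite /= mulg1 mulVg.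
exact: (group_topology_translate g^-1 (group_topology_translater g tO)).
Qed.

Lemma nbhs1_inv V : nbhs1 V -> nbhs1 [set h | V h^-1].
Proof.
case: gtau => _ _ tauV [O [tO O1 OV]]; exists [set h | O h^-1].
by split=> [| |h /OV//]; [exact: tauV|rewrite /= invg1].
Qed.

Lemma nbhs1_mul V : nbhs1 V ->
  exists2 W, nbhs1 W & forall g h, W g -> W h -> V (g * h).
Proof.
case: gtau => _ tauM _ [O [tO O1 OV]].
have [|A [B [tA tB A1 B1 ABO]]] := tauM 1 1 O tO; first by rewrite mulg1.
exists (A `&` B); last by move=> g h [Ag _] [_ Bh]; exact/OV/ABO.
by apply: nbhs1I; [exists A; split|exists B; split].
Qed.

(** Three factors serve the conjugations below: [g * x * g^-1] lies in [V] for [g] and [x] in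
    [W]. *)
Lemma nbhs1_root3 V : nbhs1 V -> exists W, [/\ nbhs1 W,
  forall g, W g -> W g^-1 &
  forall f g h, W f -> W g -> W h -> V (f * g * h)].
Proof.
move=> nV; have [W nW WV] := nbhs1_mul nV; have [X nX XW] := nbhs1_mul nW.
have nWX := nbhs1I nW nX.
exists ((W `&` X) `&` [set h | (W `&` X) h^-1]); split.
- by apply: nbhs1I => //; exact: nbhs1_inv.
- by move=> g [WXg WXg']; split=> //=; rewrite invgK.
- by move=> f g h [[_ Xf] _] [[_ Xg] _] [[Wh _] _]; exact/WV/Wh/XW.
Qed.

Lemma open_nbhs1 O g : tau O -> O g -> nbhs1 [set h | O (g * h)].
Proof.
move=> tO Og; exists [set h | O (g * h)].
by split=> //=; [exact: group_topology_translate|rewrite mulg1].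
Qed.

Lemma nbhs1_open (O : set G) :
  (forall g, O g -> nbhs1 [set h | O (g * h)]) -> tau O.
Proof.
move=> Onb; apply: topology_nbhsP => // g /Onb[W [tW W1 WO]].
exists [set h | W (g^-1 * h)]; split; [exact: group_topology_translate| |].
  by rewrite /= mulVg.
by move=> h /WO /=; rewrite mulVKg.
Qed.

Lemma nbhs1_trivial :
  (forall V, nbhs1 V -> forall g, V g) -> tau = trivial_topology G.
Proof.
move=> nT; have [tT _ tU] := top_tau.
apply/seteqP; split=> [O tO|O [->|->]//].
  have [[g Og]|O0] := pselect (exists g, O g); [right|left].
    apply/seteqP; split=> // h _; rewrite -(mulVKg g h).
    exact: (nT _ (open_nbhs1 tO Og)).
  by apply/seteqP; split=> // g Og; case: O0; exists g.
by have := tU set0; rewrite bigcup_set0; apply.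
Qed.
End GroupTopology.

(** * Large displacements in group topologies coarser than [tau_st] *)

Section Coarsest.
Context disp (R : distMonoidType disp) (U : rmetricType R).
Hypothesis uryU : urysohn U.
Local Notation d := (@rdist disp R U).
Implicit Types (s : seq U) (x y z u : U) (g h k : isom U).

Context (tau : set_system (isom U)).
Hypothesis gtau : group_topology tau.
Hypothesis tau_sub : tau `<=` tau_st U.

Lemma nbhs1_stab V : nbhs1 tau V ->
  exists A : seq U, forall g, {in A, forall a, g a = a} -> V g.
Proof.
move=> [O [/tau_sub tO O1 OV]].
have [_ [A /= /finite_seqP[s ->] <-] AO] := tO 1%g O1.
by exists s => g gs; apply/OV; rewrite -[g]mul1g; exact: AO.
Qed.

(** Combines a symmetric cube root of [V] with a finite set whose stabilizer lies in that root;
    enlarging the set is harmless, so it may contain any given [B]. *)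
Lemma nbhs1_root V (B : seq U) : nbhs1 tau V -> exists W (A : seq U),
  [/\ nbhs1 tau W /\ {subset B <= A},
    forall g, {in A, forall a, g a = a} -> W g,
    forall g, W g -> W g^-1%g &
    forall f g h, W f -> W g -> W h -> V (f * g * h)%g].
Proof.
move=> /(nbhs1_root3 gtau)[W [nW WV WWW]]; have [A AW] := nbhs1_stab nW.
exists W, (B ++ A); split=> //; first by split=> // x Bx; rewrite mem_cat Bx.
by move=> g gA; apply: AW => a Aa; apply: gA; rewrite mem_cat Aa orbT.
Qed.

(* If g moves u by more than r (+) r (+) r then, for h in the stabilizer of u
   making h A free from A over u, one of g and h^-1 g h moves u away from A. *)
Lemma escape_point (r : R) :
  (forall V u, nbhs1 tau V -> exists2 g, V g &
     (r (+) r (+) r < d (g u) u)%O) ->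
  forall V (A : seq U) u, nbhs1 tau V ->
    exists2 g, V g & {in A, forall a, (r < d (g u) a)%O}.
Proof.
move=> move_u V A u nV; apply: contrapT => noV.
have near g : V g -> exists2 a, a \in A & (d (g u) a <= r)%O.
  move=> Vg; apply: contrapT => no_a; apply: noV; exists g => // a Aa.
  by rewrite ltNge; apply/negP => ga; apply: no_a; exists a.
have [//|h hu hA] := @free_amalgam_isom _ _ _ uryU [:: u] A.
have hE : h u = u by apply: hu; rewrite mem_head.
have [g [/= Vg Vhg] gu] := move_u _ u (nbhs1I gtau nV (nbhs1_conj gtau h nV)).
have [a Aa ga] := near _ Vg; have [b Ab hb] := near _ Vhg.
have {}hb : (d (g u) (h b) <= r)%O.
  move: hb; rewrite /= hE -(isom_dist h).
  by have -> : h ((h^-1)%g (g u)) = g u by exact: (proj2 (isom_invP h)).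
have [_ /[!inE]/eqP-> hab] := hA b a Ab Aa.
move: gu; rewrite ltNge => /negP; apply.
(* [g u] is within [r] of both [a] and [h b], while by freeness [d (h b) a] is the sum of the two
   distances to [u]. *)
have au : (d a u <= r (+) r)%O.
  apply: le_trans (le_dplus ga hb).
  apply: le_trans (rdist_trianglel (g u) a (h b)).
  by rewrite (rdistC a (h b)) hab (rdistC u a) le_dplusl.
apply: le_trans (rdist_triangle _ a _) _.
by rewrite -dplusA le_dplus.
Qed.

(** A predicate rather than a bound, since in the case of [tau_st] only [0 < t] is known at first,
    whereas the later bounds are non-strict. *)
Definition far (Q : R -> Prop) := forall V (A : seq U), nbhs1 tau V ->
  exists2 g, V g & {in A &, forall x y, Q (d (g x) y)}.

(** Induction on the points to be moved. If the [g] found for [s] leaves [g x] close to some [b] in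
    [B], it is replaced by [h * k * g]: [h] drives [b] away from [B], and [k], fixing [B], makes the
    image of [g s] free from [h^-1 B] over [B], so that the points of [s] keep their distance. *)
Lemma escape_set (r r' : R) : (r (+) r <= r')%O ->
  (forall V (A : seq U) u, nbhs1 tau V ->
    exists2 g, V g & {in A, forall a, (r' < d (g u) a)%O}) ->
  far (fun t => (r < t)%O).
Proof.
move=> rr' escape.
(* The two roles of [A] are separated, since the induction hypothesis is applied with a larger set
   of points to avoid. *)
suff IH (s : seq U) V (A : seq U) : nbhs1 tau V ->
    exists2 g, V g & {in s & A, forall x y, (r < d (g x) y)%O}.
  by move=> V A; exact: IH.
elim: s V A => [|x s IHs] V A nV; first by exists 1%g; [exact: nbhs1_mem1 nV|].
have [W [B [[nW AB] BW WV WWW]]] := nbhs1_root (x :: A) nV.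
have W1 := nbhs1_mem1 nW.
have [g Wg gs] := IHs W B nW.
have [gx|/existsNP[b /not_implyP[Bb gxb]]] :=
    pselect (forall b, b \in B -> (r < d (g x) b)%O).
  exists g; first by rewrite -[g]mulg1 -[g]mulg1; exact: WWW.
  move=> y a; rewrite inE => /orP[/eqP->|sy] Aa.
    by apply/gx/AB; rewrite inE Aa orbT.
  by apply: gs => //; apply/AB; rewrite inE Aa orbT.
have [h Wh hb] := escape W B b nW.
have B0 : B != [::] by case: (B) Bb.
pose hB := [seq (h^-1)%g a | a <- B].
have [k kB kfree] := free_amalgam_isom uryU (map g s ++ hB) B0.
exists (h * k * g)%g => [|y a].
  by apply: WWW => //; exact: BW.
rewrite inE => yxs Aa; have Ba : a \in B by apply: AB; rewrite inE Aa orbT.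
have hkg z : d ((h * k * g)%g z) a = d (k (g z)) ((h^-1)%g a).
  by rewrite -[in RHS](isom_dist h) /= (proj2 (isom_invP h)).
case/orP: yxs => [/eqP->|sy]; last first.
  rewrite hkg; have [] := kfree (g y) ((h^-1)%g a).
  - by rewrite mem_cat map_f.
  - by rewrite mem_cat map_f ?orbT.
  move=> c Bc ->; exact: lt_le_trans (gs _ _ sy Bc) (le_dplusr _ _).
(* As [k] fixes [b], the point [h (k (g x))] is within [r] of [h b], which is farther than [r (+) r]
   from [a]. *)
rewrite ltNge; apply/negP => hxa; have := hb a Ba.
rewrite ltNge => /negP; apply.
apply: le_trans rr'; apply: le_trans (rdist_trianglel (h (k (g x))) _ _) _.
apply: le_dplus => //; rewrite isom_dist -(kB _ Bb) isom_dist.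
by rewrite leNgt; exact/negP.
Qed.

(** Take [g] in a root of [V] separating [B] from [g B], and [k] fixing [g B] and making [B] free
    from itself over [g B]. Each path from [k x] to [y] then crosses [g B], which yields two
    summands satisfying [Q]; and [k] is a conjugate by [g] of an element fixing [B]. *)
Lemma far_sum (Q : R -> Prop) (t : R) :
  (forall p q, Q p -> Q q -> (t <= p (+) q)%O) -> far Q ->
  far (fun r => (t <= r)%O).
Proof.
move=> Qt farQ V A nV; have [u0 _] := urysohn_inhabited (proj1 uryU).
(* [u0] makes [B], hence [map g B], non-empty: the free amalgam needs a non-empty base. *)
have [W [B [[nW AB] BW WV WWW]]] := nbhs1_root (u0 :: A) nV.
have [g Wg gQ] := farQ W B nW.
have B0 : map g B != [::].
  by have := AB u0; rewrite mem_head => /(_ isT); case: (B).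
have [k kB kfree] := free_amalgam_isom uryU B B0.
exists k => [|x y Ax Ay].
  rewrite (_ : k = g * (g^-1 * k * g) * g^-1)%g; last first.
    by rewrite !mulgA mulgV mul1g mulgK.
  apply: WWW => //; last exact: WV; apply: BW => b Bb /=.
  by rewrite kB ?map_f // (proj1 (isom_invP g)).
have {Ax}Bx : x \in B by apply: AB; rewrite inE Ax orbT.
have {Ay}By : y \in B by apply: AB; rewrite inE Ay orbT.
have [_ /mapP[c Bc ->] ->] := kfree _ _ Bx By.
by apply: Qt; [rewrite rdistC|]; exact: gQ.
Qed.

(** The bound is doubled [m] times; keeping [t <= t'] in the induction ensures that each doubling
    adds at least [t]. *)
Lemma far_archimedean (t : R) : dist_archimedean R -> t != 0 ->
  far (fun r => (t <= r)%O) -> forall D, far (fun r => (D <= r)%O).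
Proof.
move=> archR t0 fart D.
have [D0|D0] := eqVneq D 0.
  move=> V A nV; exists 1%g; first exact: nbhs1_mem1 nV.
  by move=> x y _ _; rewrite D0 dzero_le.
have [m Dm] := archR D t D0 t0.
suff [t' [mt' _ fart']] :
    exists t', [/\ (dmuln m t <= t')%O, (t <= t')%O &
      far (fun r => (t' <= r)%O)].
  move=> V A nV; have [g Vg gA] := fart' V A nV; exists g => // x y Ax Ay.
  exact: le_trans Dm (le_trans mt' (gA _ _ Ax Ay)).
elim: m {Dm} => [|m [t' [mt' tt' fart']]].
  by exists t; rewrite dzero_le.
exists (t' (+) t'); split; first exact: le_dplus.
  exact: le_trans tt' (le_dplusr _ _).
by apply: far_sum fart' => p q; exact: le_dplus.
Qed.

Lemma diameter_bound (S : seq U) :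
  exists D, {in S &, forall x y, (d x y <= D)%O}.
Proof.
elim: S => [|x S [D SD]]; first by exists 0.
have [E SE] : exists E, {in S, forall y, (d x y <= E)%O}.
  elim: (S) => [|y s [E sE]]; first by exists 0.
  exists (d x y (+) E) => z; rewrite inE => /orP[/eqP->|/sE zE].
    exact: le_dplusr.
  exact: le_trans zE (le_dplusl _ _).
exists (D (+) E) => y z; rewrite !inE => /orP[/eqP->|Sy] /orP[/eqP->|Sz].
- by rewrite rdistxx dzero_le.
- exact: le_trans (SE _ Sz) (le_dplusl _ _).
- by rewrite rdistC; exact: le_trans (SE _ Sy) (le_dplusl _ _).
- exact: le_trans (SD _ _ Sy Sz) (le_dplusr _ _).
Qed.

(* V contains k moving A to a copy at constant distance D from both A and h A;
   some p in k G_A k^-1 then agrees with h on A. *)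
Lemma far_nbhs1_full : (forall D, far (fun r => (D <= r)%O)) ->
  forall V, nbhs1 tau V -> forall h, V h.
Proof.
move=> farD V nV h.
(* One root for each construction: [k] is in [W2] as a product from [W], [p] is in [W1] as a product
   from [W2], and [h = p * (p^-1 * h)] is in [V]. *)
have [W1 [_ [[nW1 _] _ WV1 WWW1]]] := nbhs1_root [::] nV.
have [W2 [_ [[nW2 _] _ WV2 WWW2]]] := nbhs1_root [::] nW1.
have [W [A [[nW _] AW WV WWW]]] := nbhs1_root [::] nW2.
have one_W := nbhs1_mem1 nW; have one_W2 := nbhs1_mem1 nW2.
have one_W1 := nbhs1_mem1 nW1.
have W_W2 g : W g -> W2 g by rewrite -{2}[g]mulg1 -{2}[g]mulg1 => ?; exact: WWW.
have W2_W1 g : W2 g -> W1 g.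
  by rewrite -{2}[g]mulg1 -{2}[g]mulg1 => ?; exact: WWW2.
pose S := A ++ map h A.
have [D SD] := diameter_bound S.
have [g Wg gS] := farD D W S nW.
have [] := @constant_distance_isom _ _ _ uryU S (map g S) D SD.
  by move=> x _ Sx /mapP[y Sy ->]; rewrite rdistC; exact: gS.
move=> k kgS kD.
have W2k : W2 k.
  rewrite (_ : k = g * (g^-1 * k * g) * g^-1)%g; last first.
    by rewrite !mulgA mulgV mul1g mulgK.
  apply: WWW => //; last exact: WV; apply: AW => a Aa /=.
  by rewrite kgS ?map_f ?mem_cat ?Aa // (proj1 (isom_invP g)).
(* The map fixing [k A] and sending [A] to [h A] is isometric because all distances from [k A] to
   [A] and to [h A] equal [D]. *)
pose u (i : U + U) := match i with inl a => k a | inr a => a end.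
pose v (i : U + U) := match i with inl a => k a | inr a => h a end.
have SA a : a \in A -> a \in S by rewrite mem_cat => ->.
have ShA a : a \in A -> h a \in S by move=> Aa; rewrite mem_cat map_f ?orbT.
have [] := @isom_extension _ _ _ uryU _ (map inl A ++ map inr A) u v.
  move=> i j; rewrite !mem_cat.
  move=> /orP[]/mapP[a Aa ->] /orP[]/mapP[b Ab ->] //=;
    last by rewrite isom_dist.
    by rewrite !kD ?ShA ?SA.
  by rewrite ![d _ (k b)]rdistC !kD ?ShA ?SA.
move=> p pE.
have W1p : W1 p.
  rewrite (_ : p = k * (k^-1 * p * k) * k^-1)%g; last first.
    by rewrite !mulgA mulgV mul1g mulgK.
  apply: WWW2 => //; last exact: WV2; apply/W_W2/AW => a Aa /=.
  have /= -> := pE (inl a); first exact: (proj1 (isom_invP k)).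
  by rewrite mem_cat map_f.
have -> : h = (1 * p * (p^-1 * h))%g by rewrite mul1g mulVKg.
apply: WWW1 => //; apply/W2_W1/W_W2/AW => a Aa /=.
have /= <- := pE (inr a); first exact: (proj1 (isom_invP p)).
by rewrite mem_cat map_f ?orbT.
Qed.

End Coarsest.

(** * Group topologies from a base at the identity, and preimages *)

Section TopologyAt1.
Local Open Scope group_scope.
Context (G : groupType).
Implicit Types (B : set_system G) (V W O : set G) (g h : G).

Lemma topology_at1S B B' : (forall V, B V -> exists2 W, B' W & W `<=` V) ->
  topology_at1 B `<=` topology_at1 B'.
Proof.
move=> BB' O tO g /tO[V /BB'[W B'W WV] VO].
by exists W => // h /WV; exact: VO.
Qed.

Record group_base (B : set_system G) : Prop := GroupBase {
  group_base_inhabited : exists V, B V;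
  group_baseI : forall V W, B V -> B W -> exists2 X, B X & X `<=` V `&` W;
  group_base1 : forall V, B V -> V 1;
  group_baseM : forall V, B V ->
    exists2 W, B W & forall g h, W g -> W h -> V (g * h);
  group_baseV : forall V, B V -> exists2 W, B W & forall g, W g -> V g^-1;
  group_baseJ : forall V h, B V ->
    exists2 W, B W & forall g, W g -> V (h^-1 * g * h)
}.

Context (B : set_system G).
Hypothesis baseB : group_base B.

(** The interior of the translate of [V] by [g]; members of [B] may fail to be open. *)
Let inner g V : set G :=
  [set x | exists2 W, B W & forall w, W w -> V (g^-1 * x * w)].

Let inner_open g V : topology_at1 B (inner g V).
Proof.
move=> x [W BW WV]; have [X BX XW] := group_baseM baseB BW.
exists X => // y Xy; exists X => // z Xz.
have -> : g^-1 * (x * y) * z = g^-1 * x * (y * z) by rewrite !mulgA.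
exact/WV/XW.
Qed.

Let inner_id g V : B V -> inner g V g.
Proof. by exists V => // w; rewrite mulVg mul1g. Qed.

Let innerS g V x : inner g V x -> V (g^-1 * x).
Proof. by move=> [W BW /(_ 1 (group_base1 baseB BW))]; rewrite mulg1. Qed.

Lemma nbhs1_topology_at1 V : B V -> nbhs1 (topology_at1 B) V.
Proof.
move=> BV; exists (inner 1 V); split; [exact: inner_open|exact: inner_id|].
by move=> x /innerS; rewrite invg1 mul1g.
Qed.

Lemma group_topology_at1 : group_topology (topology_at1 B).
Proof.
split; first split.
- by move=> g _; have [V BV'] := group_base_inhabited baseB; exists V.
- move=> O P tO tP g [/tO[V BV' VO] /tP[W BW WP]].
  have [X BX XVW] := group_baseI baseB BV' BW; exists X => //.
  by move=> h /XVW[/VO Oh /WP Ph].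
- move=> F Ft g [O FO /(Ft _ FO)[V BV' VO]].
  by exists V => // h /VO Oh; exists O.
- move=> g h O tO /tO[V BV' VO]; have [W BW WV] := group_baseM baseB BV'.
  have [X BX XW] := group_baseJ baseB h BW.
  exists (inner g X), (inner h W).
  split; [exact: inner_open|exact: inner_open|exact: inner_id|exact: inner_id|].
  move=> x y /innerS/XW Wx /innerS Wy.
  suff -> : x * y = g * h * (h^-1 * (g^-1 * x) * h * (h^-1 * y)).
    exact/VO/WV.
  by rewrite -!mulgA mulVKg mulVKg mulVKg.
- move=> O tO g /tO[V BV' VO]; have [W BW WV] := group_baseJ baseB g^-1 BV'.
  have [X BX XW] := group_baseV baseB BW; exists X => // x /XW/WV.
  rewrite invgK => Vx.
  by have := VO _ Vx; rewrite /= invgM -!mulgA mulKg.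
Qed.

End TopologyAt1.

Lemma group_topology_preimage (G H : groupType) (f : G -> H)
    (sigma : set_system H) :
  {morph f : x y / (x * y)%g} -> group_topology sigma ->
  group_topology [set f @^-1` O | O in sigma].
Proof.
move=> fM [[sT sI sU] sM sV].
have f1 : f 1%g = 1%g by apply: (mulgI (f 1%g)); rewrite -fM !mulg1.
have fV x : f x^-1%g = (f x)^-1%g.
  by apply: (mulgI (f x)); rewrite -fM !mulgV f1.
split; first split.
- by exists setT.
- by move=> _ _ [O sO <-] [P sP <-]; exists (O `&` P); first exact: sI.
- move=> F Fs.
  (* Taking all open sets whose preimage is in [F] avoids choosing one for each member of [F]. *)
  exists (\bigcup_(O in [set O | sigma O /\ F (f @^-1` O)]) O).
    by apply: sU => O [].
  apply/seteqP; split=> x /=.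
    by move=> [O [_ FO] Ofx]; exists (f @^-1` O).
  move=> [A FA Ax]; have [O sO OA] := Fs _ FA.
  by exists O; [split=> //; rewrite OA|move: Ax; rewrite -OA].
- move=> g h _ [O sO <-] /=; rewrite fM => Ogh.
  have [V [W [sV' sW Vg Wh VW]]] := sM _ _ _ sO Ogh.
  exists (f @^-1` V), (f @^-1` W); split=> //; [by exists V|by exists W|].
  by move=> x y Vx Wy; rewrite /= fM; exact: VW.
- move=> _ [O sO <-]; exists [set y | O y^-1%g]; first exact: sV.
  by apply/seteqP; split=> x /=; rewrite fV.
Qed.

(** * The topologies [tau_m] and [tau_st], coarseness and total minimality *)

Section UrysohnTopologies.
Context disp (R : distMonoidType disp) (U : rmetricType R).
Local Notation d := (@rdist disp R U).
Implicit Types (E : R -> Prop) (u : U) (e : R) (g h : isom U).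

Definition ball_cap (s : seq (U * R)) : set (isom U) :=
  [set g | {in s, forall p, (d (g p.1) p.1 <= p.2)%O}].

Lemma ball_cap_cons p s :
  ball_cap (p :: s) = displ_ball p.1 p.2 `&` ball_cap s.
Proof.
apply/seteqP; split=> g => [gs|[gp gs] q].
  by split=> [|q qs]; apply: gs; rewrite ?mem_head // inE qs orbT.
by rewrite inE => /orP[/eqP->|/gs].
Qed.

(** Treats both topologies at once: non-zero radii give [tau_m], the radius 0 gives [tau_st]. *)
Definition ball_base E : set_system (isom U) :=
  [set ball_cap s | s in [set s | {in s, forall p, E p.2}]].

Lemma ball_base1 E u e : E e -> ball_base E (displ_ball u e).
Proof.
move=> Ee; exists [:: (u, e)]; first by move=> p /[!inE]/eqP->.
apply/seteqP; split=> g.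
  by move=> /(_ (u, e)) /=; apply; rewrite mem_head.
by move=> gu p /[!inE]/eqP->.
Qed.

(** Halving serves products; inversion preserves each ball, and conjugation by [h] moves its centre
    by [h]. *)
Lemma group_base_ball_base E :
  (forall e, E e -> exists2 r, E r & (r (+) r <= e)%O) ->
  group_base (ball_base E).
Proof.
move=> Ehalf; split.
- by exists (ball_cap [::]), [::].
- move=> _ _ [s Es <-] [t Et <-]; exists (ball_cap (s ++ t)).
    exists (s ++ t) => //= p; rewrite mem_cat => /orP[]; [exact: Es|exact: Et].
  by move=> g gst; split=> p ps; apply: gst; rewrite mem_cat ps ?orbT.
- by move=> _ [s _ <-] p _ /=; rewrite rdistxx dzero_le.
- move=> _ [s Es <-].
  have /choice[r rP] (e : R) : exists r, E e -> E r /\ (r (+) r <= e)%O.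
    have [/Ehalf[r Er re]|nE] := pselect (E e); first by exists r.
    by exists e.
  exists (ball_cap [seq (p.1, r p.2) | p <- s]).
    by eexists; last by []; move=> _ /mapP[p /Es/rP[] ? _ ->].
  move=> g h gs hs p sp; have [_ rp] := rP _ (Es _ sp).
  have /= gp := gs _ (map_f (fun p => (p.1, r p.2)) sp).
  have /= hp := hs _ (map_f (fun p => (p.1, r p.2)) sp).
  apply: le_trans rp; apply: le_trans (rdist_triangle _ (g p.1) _) _.
  by apply: le_dplus; rewrite //= isom_dist.
- move=> _ [s Es <-]; exists (ball_cap s); first by exists s.
  move=> g gs p sp; rewrite -(isom_dist g) /= (proj2 (isom_invP g)) rdistC.
  exact: gs.
- move=> _ h [s Es <-]; exists (ball_cap [seq (h p.1, p.2) | p <- s]).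
    by eexists; last by []; move=> _ /mapP[p /Es ? ->].
  move=> g gs p sp; rewrite -(isom_dist h) /= (proj2 (isom_invP h)).
  exact: (gs _ (map_f (fun p => (h p.1, p.2)) sp)).
Qed.

Lemma tau_mE : tau_m U = topology_at1 (ball_base (fun r => r != 0)).
Proof.
apply/seteqP; split; apply: topology_at1S.
- move=> _ [D Ds <-]; have /finite_seqP[s Ds_s] := finite_fset D.
  have sD p : p \in s -> p \in D.
    by move=> ps; have : [set` D] p by rewrite Ds_s.
  exists (ball_cap s); first by exists s => // p /sD/Ds/set_mem.
  by move=> g gs p; rewrite Ds_s; exact: gs.
- move=> _ [s Es <-]; exists (ball_cap s) => //.
  elim: s Es => [|p s IHs] Es.
    rewrite (_ : ball_cap [::] = setT); last by apply/seteqP; split.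
    by exists fset0 => [p|]; rewrite ?inE ?set_fset0 ?bigcap_set0.
  rewrite ball_cap_cons; apply: finI_fromI.
    by apply: finI_from1; apply: Es; rewrite mem_head.
  by apply: IHs => q sq; apply: Es; rewrite inE sq orbT.
Qed.

Lemma tau_stE : tau_st U = topology_at1 (ball_base (fun r => r = 0)).
Proof.
apply/seteqP; split; apply: topology_at1S.
- move=> _ [A /finite_seqP[s ->] <-].
  exists (ball_cap [seq (x, 0) | x <- s]).
    by eexists; last by []; move=> _ /mapP[x _ ->].
  move=> g gs x sx; apply/(@rdist_eq0 _ R)/dle0.
  exact: (gs _ (map_f (fun x => (x, 0)) sx)).
- move=> _ [s Es <-]; exists (pointwise_stab [set` map fst s]).
    by exists [set` map fst s] => //; exact: finite_seq.
  move=> g gs p sp; rewrite gs ?rdistxx ?dzero_le //=.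
  exact: map_f.
Qed.

Lemma ball_base_sub_st E : topology_at1 (ball_base E) `<=` tau_st U.
Proof.
rewrite tau_stE; apply: topology_at1S => _ [s Es <-].
exists (ball_cap [seq (p.1, 0) | p <- s]).
  by eexists; last by []; move=> _ /mapP[p _ ->].
move=> g gs p sp; apply: le_trans (dzero_le p.2).
exact: (gs _ (map_f (fun p => (p.1, 0)) sp)).
Qed.

Lemma ball_base_sub E (tau : set_system (isom U)) : group_topology tau ->
  (forall u e, E e -> nbhs1 tau (displ_ball u e)) ->
  topology_at1 (ball_base E) `<=` tau.
Proof.
move=> gtau Enb O tO; apply: nbhs1_open => // g /tO[_ [s Es <-] sO].
apply: nbhs1S sO _; elim: s Es => [|p s IHs] Es.
  by have [[tT _ _] _ _] := gtau; exists setT.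
rewrite ball_cap_cons; apply: nbhs1I => //.
  by apply/Enb/Es; rewrite mem_head.
by apply: IHs => q sq; apply: Es; rewrite inE sq orbT.
Qed.

Definition tau_radius e : Prop :=
  if `[< dist_halving R >] then is_true (e != 0) else e = 0.

Lemma tau_isomE : tau_isom U = topology_at1 (ball_base tau_radius).
Proof.
rewrite /tau_isom /tau_radius.
by case: ifP => _; rewrite ?tau_mE ?tau_stE.
Qed.

Lemma tau_radius_half e :
  tau_radius e -> exists2 r, tau_radius r & (r (+) r <= e)%O.
Proof.
rewrite /tau_radius; case: asboolP => [+|_ ->]; first exact.
by exists 0; rewrite ?dplus0.
Qed.

Hypothesis archR : dist_archimedean R.

(** Without halving, [r = 0] will do. With halving, failure makes [e] the least non-zero element, so
    [e (+) e = e], and the archimedean property leaves only 0 and [e]. *)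
Lemma tau_radius_small e : ~ two_element R -> e != 0 ->
  exists2 r, tau_radius r & (r (+) r < e)%O.
Proof.
move=> no2 e0; have gt0 t : t != 0 -> (0 < t)%O.
  by rewrite lt_neqAle dzero_le eq_sym => ->.
rewrite /tau_radius; case: asboolP => [half|_]; last first.
  by exists 0; rewrite ?dplus0 ?gt0.
apply: contrapT => nor; apply: no2; exists e => // t.
have emin s : s != 0 -> (e <= s)%O.
  move=> s0; rewrite leNgt; apply/negP => se; apply: nor.
  by have [r r0 rs] := half s s0; exists r => //; exact: le_lt_trans rs se.
have ee : e (+) e = e.
  apply/le_anti; rewrite le_dplusr andbT.
  have [s /emin es sse] := half e e0.
  exact: le_trans (le_dplus es es) sse.
have [->|t0] := eqVneq t 0; [by left|right].
have [m tm] := archR t0 e0; apply/le_anti; rewrite emin // andbT.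
apply: le_trans tm _; elim: m => [|m IHm]; first exact: dzero_le.
by rewrite /= -[leRHS]ee le_dplus.
Qed.

Hypothesis uryU : urysohn U.

Lemma tau_isom_hausdorff : ~ two_element R -> hausdorff_topology (tau_isom U).
Proof.
move=> no2 g h gh; rewrite tau_isomE.
have base := group_base_ball_base tau_radius_half.
have gt := group_topology_at1 base.
have [u gu] : exists u, g u <> h u.
  by apply/existsNP => gh'; apply/gh/isom_ext.
(* With [r (+) r] below the distance of [g u] and [h u], no [x u] is within [r] of both. *)
have [|r rad_r rlt] := @tau_radius_small (d (g u) (h u)) no2.
  by apply/eqP => /rdist_eq0.
have BI g0 V : ball_base tau_radius V -> exists O,
    [/\ topology_at1 (ball_base tau_radius) O, O g0 &
        forall x, O x -> V (g0^-1 * x)%g].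
  move=> BV; have [O [tO O1 OV]] := nbhs1_topology_at1 base BV.
  exists [set x | O (g0^-1 * x)%g].
  split=> [| |x /OV//]; last by rewrite /= mulVg.
  exact: (group_topology_translate gt g0^-1%g tO).
have [A [tA Ag AV]] := BI g _ (ball_base1 u rad_r).
have [B [tB Bh BV]] := BI h _ (ball_base1 u rad_r).
exists A, B; split=> //; apply/seteqP; split=> // x [/AV/= xg /BV/= xh].
move: rlt; rewrite ltNge => /negP; apply.
have tr (k : isom U) : displ_ball u r (k^-1 * x)%g -> (d (x u) (k u) <= r)%O.
  by rewrite /displ_ball /= -(isom_dist k) /= (proj2 (isom_invP k)).
apply: le_trans (rdist_trianglel (x u) (g u) (h u)) _.
apply: le_dplus; exact: tr.

Qed.

Lemma nbhs1_displ_ball (tau : set_system (isom U)) : group_topology tau ->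
  tau `<=` tau_st U -> tau <> trivial_topology (isom U) ->
  forall u e, tau_radius e -> nbhs1 tau (displ_ball u e).
Proof.
move=> gtau tau_sub tau_nt u e rad_e; apply: contrapT => nball; apply: tau_nt.
(* Conjugation by an isometry taking [u] to [w] transfers the failure at [u] to every point. *)
have move_pt V w : nbhs1 tau V -> exists2 g, V g & (e < d (g w) w)%O.
  move=> nV; have [h hu] := isom_transitive uryU u w.
  apply: contrapT => noV; apply: nball.
  apply: nbhs1S (nbhs1_conj gtau h^-1%g nV) => g /= Vg.
  rewrite /displ_ball /= leNgt; apply/negP => egu; apply: noV.
  exists (h^-1^-1 * g * h^-1)%g => //.
  by rewrite invgK /= -hu (proj1 (isom_invP h)) isom_dist.
(* Three halvings: [r' (+) r' (+) r' <= s (+) s <= e] serves [escape_point], and [r (+) r <= r']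
   serves [escape_set]. For [tau_st] all these radii are 0. *)
have [s rad_s ss] := tau_radius_half rad_e.
have [r' rad_r' rr'] := tau_radius_half rad_s.
have [r rad_r rr] := tau_radius_half rad_r'.
have far_r : far tau (fun t => (r < t)%O).
  apply: (escape_set uryU gtau tau_sub rr) => V A w nV.
  apply: (escape_point uryU gtau _ A w nV) => {A nV}V {}w nV.
  have [g Vg gw] := move_pt V w nV.
  exists g => //; apply: le_lt_trans gw; apply: le_trans ss.
  by rewrite le_dplus // (le_trans (le_dplusr _ _) rr').
have [t t0 far_t] : exists2 t, t != 0 & far tau (fun p => (t <= p)%O).
  move: rad_r far_r; rewrite /tau_radius.
  case: asboolP => [_ r0 far_r|nhalf -> far_r].
    exists r => // V A /(far_r V A)[g Vg gA]; exists g => // x y Ax Ay.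
    exact/ltW/gA.
  (* The failure of halving provides [t]; one application of [far_sum] then improves [0 < d] to
     [t <= d]. *)
  have [t t0 tt] : exists2 t, t != 0 & forall s : R, s != 0 -> (t <= s (+) s)%O.
    apply: contrapT => not_; apply: nhalf => p p0; apply: contrapT => np.
    apply: not_; exists p => // q q0; rewrite leNgt; apply/negP => qq.
    by apply: np; exists q => //; exact: ltW.
  exists t => //; apply: far_sum far_r => // p q p0 q0.
  have [pq|/ltW qp] := leP p q.
    by apply: le_trans (tt p _) _; rewrite ?le_dplus // gt_eqF.
  by apply: le_trans (tt q _) _; rewrite ?le_dplus // gt_eqF.
apply: nbhs1_trivial => //; apply: far_nbhs1_full => //.
exact: far_archimedean far_t.
Qed.

Lemma tau_isom_coarsest (tau : set_system (isom U)) : group_topology tau ->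
  tau `<=` tau_st U -> tau <> trivial_topology (isom U) ->
  tau_isom U `<=` tau.
Proof.
move=> gtau tau_sub tau_nt; rewrite tau_isomE.
by apply: ball_base_sub => //; exact: nbhs1_displ_ball.
Qed.

Lemma tau_isom_group_topology : group_topology (tau_isom U).
Proof.
rewrite tau_isomE; apply/group_topology_at1/group_base_ball_base.
exact: tau_radius_half.
Qed.

Lemma tau_isom_sub_st : tau_isom U `<=` tau_st U.
Proof. by rewrite tau_isomE; exact: ball_base_sub_st. Qed.

Lemma isom_nontrivial : (exists r : R, r != 0) -> exists g : isom U, g <> 1%g.
Proof.
move=> [r r0]; have [univU _] := uryU; have [u0 _] := urysohn_inhabited univU.
pose rho (a b : bool) : R := if a == b then 0 else r.
have [|||f fE] :=
  @pseudometric_embedding _ R U univU _ [:: true; false] rho _ _ _ u0.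
- by move=> a _; rewrite /rho eqxx.
- by move=> a b _ _; rewrite /rho eq_sym.
- by move=> [] [] [] _ _ _; rewrite /rho /= ?dplus0 ?dplus0l ?dzero_le ?lexx.
have [g gE] := isom_transitive uryU (f true) (f false).
exists g => g1; move: gE; rewrite g1 /= => /(@rdist_eq0 _ R).
by rewrite fE //= => re; rewrite /rho /= in re; rewrite re eqxx in r0.
Qed.

(** If the preimage of [sigma] is non-trivial, it contains [tau_isom U] by coarseness, so each open
    set is a preimage and its image is open by surjectivity. *)
Lemma tau_isom_totally_minimal : totally_minimal (tau_isom U).
Proof.
move=> H sigma f gs hs fM fsurj fcont O tO.
have gp := group_topology_preimage fM gs.
have psub : [set f @^-1` P | P in sigma] `<=` tau_st U.
  by move=> _ [P /fcont tP <-]; exact: tau_isom_sub_st.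
have [ptriv|pnt] :=
    pselect ([set f @^-1` P | P in sigma] = trivial_topology (isom U)).
  have [[sT sI sU] _ _] := gs.
  (* Here every non-empty open set of [H] is all of [H], so the Hausdorff axiom leaves a single
     point. *)
  have one (x y : H) : x = y.
    apply: contrapT => /hs[A [B [sA sB Ax By AB0]]].
    have full (P : set H) z : sigma P -> P z -> P = setT.
      move=> sP Pz.
      have : [set f @^-1` P | P in sigma] (f @^-1` P) by exists P.
      have [w fw] := fsurj z.
      rewrite ptriv => -[P0|PT].
        by have : (f @^-1` P) w; [rewrite /= fw|rewrite P0].
      apply/seteqP; split=> // v _; have [w' <-] := fsurj v.
      by have : (f @^-1` P) w' by rewrite PT.
    have : (A `&` B) x by rewrite (full _ _ sA Ax) (full _ _ sB By).
    by rewrite AB0.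
  have [[g Og]|O0] := pselect (exists g, O g).
    suff -> : f @` O = setT by [].
    by apply/seteqP; split=> // y _; exists g.
  suff -> : f @` O = set0 by have := sU set0; rewrite bigcup_set0; apply.
  by apply/seteqP; split=> // y [g Og]; case: O0; exists g.
have [P sP <-] := tau_isom_coarsest gp psub pnt tO.
suff -> : f @` (f @^-1` P) = P by [].
apply/seteqP; split=> [_ [x Px <-] //|y Py].
by have [x xy] := fsurj y; exists x; rewrite //= xy.
Qed.

End UrysohnTopologies.

Theorem theoremC (disp : Order.disp_t) (R : distMonoidType disp)
    (U : rmetricType R)
    (countR : countable [set: R])
    (archR : dist_archimedean R)
    (uryU : urysohn U) :
  [/\ group_topology (tau_isom U) /\ tau_isom U `<=` tau_st U,
      (exists r : R, r != 0) -> ~ two_element R ->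
        tau_isom U <> trivial_topology (isom U),
      forall tau' : set_system (isom U), group_topology tau' ->
        tau' `<=` tau_st U -> tau' <> trivial_topology (isom U) ->
        tau_isom U `<=` tau',
      ~ two_element R -> hausdorff_topology (tau_isom U) &
      totally_minimal (tau_isom U)].
Proof.
have haus : ~ two_element R -> hausdorff_topology (tau_isom U).
  exact: tau_isom_hausdorff.
split=> //.
- by split; [exact: tau_isom_group_topology|exact: tau_isom_sub_st].
(* The trivial topology cannot separate some [g <> 1] from 1. *)
- move=> /(isom_nontrivial uryU)[g g1] /haus/(_ _ _ g1).
  move=> [A [B [+ + Ag B1 AB0]]] tauT.
  rewrite tauT => -[A0|AT] [B0|BT].
  - by rewrite A0 in Ag.
  - by rewrite A0 in Ag.
  - by rewrite B0 in B1.
  - by have : (A `&` B) g; [rewrite AT BT|rewrite AB0].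
- exact: tau_isom_coarsest.
- exact: tau_isom_totally_minimal.
Qed.
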